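(* Let $\Omega\subseteq\mathbb{C}$ be non-empty, let $\{(z_j,w_j)\}_{j=0}^{n}\subseteq\Omega\times\Omega$ be a training data set, and put $\bm{w}=(w_0,\dots,w_n)^T$. Let $K:\Omega\times\Omega\to\mathbb{C}$ be a positive definite kernel with associated reproducing kernel Hilbert space $\mathcal{H}_K$ and norm $\|\cdot\|_{\mathcal{H}_K}$. Let $g:[0,\infty)\to\mathbb{R}$ be strictly monotonically increasing, and let $L_{\bm{w}}:\mathbb{C}^{n+1}\to\mathbb{R}\cup\{\infty\}$ be an arbitrary loss function. Consider the functional $J:\mathcal{H}_K\to\mathbb{R}$ (assumed to take values in $\mathbb{R}$) defined by $$J(f)=L_{\bm{w}}\big(f(z_0),\dots,f(z_n)\big)+g\big(\|f\|_{\mathcal{H}_K}\big),\qquad f\in\mathcal{H}_K.$$ Then any solution $f_*$ of the optimization problem $f_*=\arg\min_{f\in\mathcal{H}_K}J(f)$ has the form $$f_*(\cdot)=\sum_{k=0}^{n}\alpha_k K(\cdot,z_k)$$ for some $\alpha_0,\dots,\alpha_n\in\mathbb{C}$.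
   Context: A positive definite kernel on $\Omega$ is a function $K:\Omega\times\Omega\to\mathbb{C}$ with $\sum_{i,j=1}^N c_i\overline{c_j}K(\omega_i,\omega_j)\ge 0$ for all $N\in\mathbb{N}$, $\omega_1,\dots,\omega_N\in\Omega$, $c_1,\dots,c_N\in\mathbb{C}$. The associated reproducing kernel Hilbert space $\mathcal{H}_K$ is the Hilbert space of functions $\Omega\to\mathbb{C}$ such that $K_\omega:=K(\cdot,\omega)\in\mathcal{H}_K$ and $\langle f,K_\omega\rangle=f(\omega)$ for all $\omega\in\Omega$, $f\in\mathcal{H}_K$. *)

(* Defs.v *)
From HB Require Import structures.
From mathcomp Require Import all_boot all_order all_algebra.
From mathcomp Require Import sesquilinear.
From mathcomp Require Export complex.
From mathcomp Require Import all_classical all_reals all_analysis.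

Set Implicit Arguments.
Unset Strict Implicit.
Unset Printing Implicit Defensive.

Import Order.TTheory GRing.Theory Num.Theory.
Import numFieldNormedType.Exports.

Local Open Scope classical_set_scope.
Local Open Scope ring_scope.

(* [0 <= z] in [R[i]] means that z is real and nonnegative. *)
Definition positive_definite_kernel (R : realType) (X : Type)
    (K : X -> X -> R[i]) : Prop :=
  forall (N : nat) (x : 'I_N -> X) (c : 'I_N -> R[i]),
    0 <= \sum_(i < N) \sum_(j < N) c i * (c j)^* * K (x i) (x j).

(* [hdot] is linear in its first argument, conjugate-linear in its second. *)
HB.mixin Record isHilbert (R : realType) H & CompleteNormedModule R[i] H := {
  hdot : {dot H for Num.conj};
  hdot_norm : forall f : H, `|f| ^+ 2 = hdot f f
}.

#[short(type="hilbertType")]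
HB.structure Definition Hilbert (R : realType) :=
  {H of CompleteNormedModule R[i] H & isHilbert R H}.

(* A linear subspace [S] of [X -> R[i]] whose elements form a Hilbert space;
   for [f : H], the underlying function is [val f]. The norm is not related
   to any topology on [X -> R[i]]. *)
#[short(type="funHilbertType")]
HB.structure Definition FunHilbert (R : realType) (X : Type)
    (S : pred (X -> R[i])) :=
  {H of Hilbert R H & GRing.SubLmodule R[i] S H}.

(* The norm of a normed module over [R[i]] is valued in [R[i]] (with zero
   imaginary part). *)
Definition hnorm (R : realType) (H : hilbertType R) (f : H) : R :=
  complex.Re `|f|.

Definition is_rkhs (R : realType) (X : Type) (K : X -> X -> R[i])
    (S : pred (X -> R[i])) (H : funHilbertType S) : Prop :=
  forall x : X, exists2 Kx : H,
    (forall y, val Kx y = K y x) & (forall f : H, hdot f Kx = val f x).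

Definition strictly_increasing_on_nonneg (R : realType) (g : R -> R) : Prop :=
  {in `[0, +oo[ &, {homo g : s t / s < t}}.

Definition is_argmin (R : realType) (T : Type) (J : T -> R) (t : T) : Prop :=
  forall u : T, J t <= J u.

(* Main.v *)
Require Import Defs.
From HB Require Import structures.
From mathcomp Require Import all_boot all_order all_algebra.
From mathcomp Require Import all_classical all_reals all_analysis.

Set Implicit Arguments.
Unset Strict Implicit.
Unset Printing Implicit Defensive.

Import Order.TTheory GRing.Theory Num.Theory.
Import numFieldNormedType.Exports.

Local Open Scope classical_set_scope.
Local Open Scope ring_scope.

(** The data z_0, ..., z_n enter J only through the inner products of f with the
    kernel sections e_k = K(., z_k), by the reproducing property. Split a
    minimiser as fstar = p + v with p in the span of the e_k and v orthogonal to
    every e_k ([orthogonal_decomposition]). Then p and fstar agree at all the z_k,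
    so they have the same loss, while Pythagoras gives |p| < |fstar| unless
    v = 0 ([hnorm_lt_orthD]). As g is strictly increasing, v <> 0 would make
    J p < J fstar; hence v = 0 and fstar = p.

    The span is finite-dimensional, so p is obtained by Gram-Schmidt. *)

(** The Gram-Schmidt step, by induction on the length of the family: the
    residual v of f for the family without its first vector is corrected along
    the residual u of that first vector. The family may be linearly dependent. *)
Lemma orthogonal_decomposition (C : numClosedFieldType) (U : lmodType C)
    (form : {dot U for Num.conj}) (m : nat) (e : 'I_m -> U) (f : U) :
  exists (a : 'I_m -> C) (v : U),
    f = \sum_k a k *: e k + v /\ forall k, form v (e k) = 0.
Proof.
elim: m e f => [|m IHm] e f.
  by exists (fun=> 0), f; split=> [|[]//]; rewrite big_ord0 add0r.
have [b [u [e0E uP]]] := IHm (e \o lift ord0) (e ord0).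
have [a [v [fE vP]]] := IHm (e \o lift ord0) f.
(* When u = 0 the quotient is 0 by convention, which is the right value: e 0 is
   then in the span of the other vectors. *)
pose c := form v u / form u u.
have cE : c * form u u = form v u.
  rewrite /c; have [->|u0] := eqVneq u 0; first by rewrite !linear0r.
  by rewrite divfK ?dnorm_eq0.
have wP k : form (v - c *: u) (e (lift ord0 k)) = 0.
  by rewrite linearBl linearZl_LR /= (vP k) (uP k) mulr0 subr0.
exists (fun k => if unlift ord0 k is Some j then a j - c * b j else c).
exists (v - c *: u); split=> [|k].
  rewrite big_ord_recl unlift_none.
  under eq_bigr do rewrite liftK scalerBl -scalerA.
  rewrite sumrB -scaler_sumr {1}fE e0E scalerDr /=.
  by rewrite -addrA [RHS]addrC addrACA !subrK.
have [j ->|->] := unliftP ord0 k; first exact: wP.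
rewrite e0E linearDr linear_sumr /= big1 ?add0r => [|j _].
  by rewrite linearBl linearZl_LR /= cE subrr.
by rewrite linearZr_LR /= wP mulr0.
Qed.

Lemma hnorm_ge0 (R : realType) (H : hilbertType R) (f : H) : 0 <= hnorm f.
Proof. by have := normr_ge0 f; rewrite lecE => /andP[]. Qed.

(** Pythagoras: |p + v|^2 = |p|^2 + |v|^2, and |v|^2 > 0. *)
Lemma hnorm_lt_orthD (R : realType) (H : hilbertType R) (p v : H) :
  hdot p v = 0 -> v != 0 -> hnorm p < hnorm (p + v).
Proof.
move=> pv0 v0; suff : `|p| < `|p + v| by rewrite ltcE => /andP[].
rewrite -(ltr_pXn2r (ltn0Sn 1)) ?nnegrE ?normr_ge0// !hdot_norm.
by rewrite hnormDd// ltrDl dnorm_gt0.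
Qed.

Theorem theorem3p1 (R : realType) (Omega : set R[i]) (n : nat)
    (z w : 'I_n.+1 -> Omega) (K : Omega -> Omega -> R[i])
    (S : pred (Omega -> R[i])) (HK : funHilbertType S)
    (g : R -> R) (L : 'cV[R[i]]_n.+1 -> 'cV[R[i]]_n.+1 -> \bar R)
    (J : HK -> R) :
  Omega !=set0 ->
  positive_definite_kernel K ->
  is_rkhs K HK ->
  strictly_increasing_on_nonneg g ->
  (forall v, L (\col_j val (w j)) v != -oo%E) ->
  (forall f : HK, (J f)%:E =
     (L (\col_j val (w j)) (\col_j val f (z j)) + (g (hnorm f))%:E)%E) ->
  forall fstar : HK, is_argmin J fstar ->
  exists alpha : 'I_n.+1 -> R[i],
    forall x : Omega, val fstar x = \sum_(k < n.+1) alpha k * K x (z k).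
Proof.
move=> _ _ rkhs g_incr _ JE fstar fstar_min.
have [e e_val e_repr] : exists2 e : 'I_n.+1 -> HK,
    (forall k y, val (e k) y = K y (z k)) &
    (forall k f, hdot f (e k) = val f (z k)).
  have /choice[e eP] k : exists Kz : HK, (forall y, val Kz y = K y (z k)) /\
      forall f, hdot f Kz = val f (z k).
    by have [Kz] := rkhs (z k); exists Kz.
  by exists e => k; have [] := eP k.
have [a [v [fstarE v_orth]]] := orthogonal_decomposition hdot e fstar.
set p := \sum_k _ in fstarE.
have pv0 : hdot p v = 0.
  rewrite linear_sumlz big1// => k _.
  have /eqP := v_orth k; rewrite herm_eq0C => /eqP ev0.
  by rewrite linearZl_LR /= ev0 mulr0.
have v0 : v = 0.
  apply/eqP/negP => /negP v_neq0.
  have lt_g : g (hnorm p) < g (hnorm fstar).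
    apply: g_incr; rewrite ?in_itv/= ?andbT ?hnorm_ge0//.
    by rewrite fstarE hnorm_lt_orthD.
  have p_data : \col_j val p (z j) = \col_j val fstar (z j).
    apply/matrixP => i j; rewrite !mxE -!e_repr fstarE linearDl /=.
    by rewrite v_orth addr0.
  have Jp := JE p; rewrite p_data in Jp; have Jfstar := JE fstar.
  have := fstar_min p; apply/negP; rewrite -ltNge.
  move: Jp Jfstar; case: (L _ _) => [r [->] [->]|//|//].
  by rewrite ltrD2l.
(* Evaluating at x is pairing with K(., x), which is linear. *)
exists a => x; have [Kx _ Kx_repr] := rkhs x.
rewrite -Kx_repr fstarE v0 addr0 linear_sumlz.
by apply: eq_bigr => k _; rewrite linearZl_LR /= Kx_repr e_val.
Qed.
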